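(* Let $m\ge 3$ and $n=2m$. Let $\pi$ be a permutation of $\mathbb{F}_2^m$ and $h_1\colon\mathbb{F}_2^m\to\mathbb{F}_2$ a Boolean function such that $f_1(x,y)=x\cdot\pi(y)+h_1(y)$, $(x,y)\in\mathbb{F}_2^m\times\mathbb{F}_2^m$, is a bent function whose unique $m$-dimensional $\mathcal{M}$-subspace is the canonical one, $U=\mathbb{F}_2^m\times\{0_m\}$. Let $L$ be a linear permutation of $\mathbb{F}_2^n$ such that $f_1(L(x,y))$ has a unique $m$-dimensional $\mathcal{M}$-subspace $U'$ and $U'\neq U$. Define Boolean functions on $\mathbb{F}_2^n$ by $$f_2(x,y)=f_1(x,y),\quad f_3(x,y)=f_1(L(x,y)),\quad f_4(x,y)=f_3(x,y)+1.$$ Then $f=f_1||f_2||f_3||f_4$, a Boolean function in $n+2$ variables, is bent and outside $\mathcal{M}^{\#}$.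
   Context: A Boolean function $f\colon\mathbb{F}_2^n\to\mathbb{F}_2$ ($n$ even) is bent if $W_f(u)=\sum_{x\in\mathbb{F}_2^n}(-1)^{f(x)+u\cdot x}=\pm 2^{n/2}$ for all $u\in\mathbb{F}_2^n$, where $\cdot$ is the standard scalar product over $\mathbb{F}_2$. $D_aD_bf(x)=f(x+a+b)+f(x+a)+f(x+b)+f(x)$. A linear subspace $V$ of $\mathbb{F}_2^n$ is an $\mathcal{M}$-subspace of $f$ if $D_aD_bf$ is identically $0$ for all $a,b\in V$. $0_m$ is the zero vector of $\mathbb{F}_2^m$. The Maiorana-McFarland class $\mathcal{M}$ in $2m$ variables is the set of functions $f(x,y)=x\cdot\pi(y)+h(y)$, $x,y\in\mathbb{F}_2^m$, with $\pi$ a permutation of $\mathbb{F}_2^m$ and $h$ an arbitrary Boolean function on $\mathbb{F}_2^m$. The completed class $\mathcal{M}^{\#}$ is the set of all functions EA-equivalent to a function in $\mathcal{M}$, where $f,f'$ are EA-equivalent if $f'=f\circ A+l$ for some affine permutation $A$ and some affine Boolean function $l$. The 4-concatenation $f=f_1||f_2||f_3||f_4$ of functions on $\mathbb{F}_2^n$ is the function on $\mathbb{F}_2^{n+2}$ with $f(\cdot,0,0)=f_1$, $f(\cdot,0,1)=f_2$, $f(\cdot,1,0)=f_3$, $f(\cdot,1,1)=f_4$. *)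

(* Defs.v *)
From mathcomp Require Import all_boot all_order all_algebra all_fingroup.
Set Implicit Arguments.
Unset Strict Implicit.
Unset Printing Implicit Defensive.
Import GRing.Theory.
Local Open Scope ring_scope.

Notation boolfun n := ('rV['F_2]_n -> 'F_2).

Definition dot n (u v : 'rV['F_2]_n) : 'F_2 := \sum_(i < n) u 0 i * v 0 i.

Definition walsh n (f : boolfun n) (u : 'rV['F_2]_n) : int :=
  \sum_(x : 'rV['F_2]_n) (-1) ^+ nat_of_ord (f x + dot u x).

Definition bent n (f : boolfun n) : Prop :=
  ~~ odd n /\
  forall u, walsh f u = 2%:Z ^+ n./2 \/ walsh f u = - (2%:Z ^+ n./2).

Definition deriv2 n (a b : 'rV['F_2]_n) (f : boolfun n) : boolfun n :=
  fun x => f (x + a + b) + f (x + a) + f (x + b) + f x.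

Definition Msubspace n (f : boolfun n) (V : {vspace 'rV['F_2]_n}) : Prop :=
  forall a b, a \in V -> b \in V -> forall x, deriv2 a b f x = 0.

Definition unique_Msubspace n (f : boolfun n) (k : nat)
    (V : {vspace 'rV['F_2]_n}) : Prop :=
  unique (fun W : {vspace 'rV['F_2]_n} => \dim W = k /\ Msubspace f W) V.

(* A vector (x, y) of F_2^m x F_2^m is encoded as [row_mx x y]. *)
Definition canonical_subspace m : {vspace 'rV['F_2]_(m + m)} :=
  lker (linfun (@rsubmx 'F_2 1 m m)).

Lemma mem_canonical_subspace m (x y : 'rV['F_2]_m) :
  (row_mx x y \in canonical_subspace m) = (y == 0).
Proof. by rewrite memv_ker lfunE /= row_mxKr. Qed.

(* The number of variables is an arbitrary [n], together with a proof that it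
   is of the form [m + m], because [n + 2] is not convertible to a sum of two
   equal terms. *)
Definition maiorana_mcfarland n (f : boolfun n) : Prop :=
  exists (m : nat) (e : (m + m)%N = n) (pi : {perm 'rV['F_2]_m})
    (h : boolfun m),
    forall x y : 'rV['F_2]_m,
      f (castmx (erefl 1%N, e) (row_mx x y)) = dot x (pi y) + h y.

Definition affine_permutation n (A : 'rV['F_2]_n -> 'rV['F_2]_n) : Prop :=
  bijective A /\ exists (M : 'M['F_2]_n) (c : 'rV['F_2]_n),
    forall x, A x = x *m M + c.

Definition affine_boolfun n (l : boolfun n) : Prop :=
  exists (u : 'rV['F_2]_n) (c : 'F_2), forall x, l x = dot u x + c.

Definition EA_equivalent n (f f' : boolfun n) : Prop :=
  exists (A : 'rV['F_2]_n -> 'rV['F_2]_n) (l : boolfun n),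
    [/\ affine_permutation A, affine_boolfun l
      & forall x, f' x = f (A x) + l x].

Definition completed_MM n (f : boolfun n) : Prop :=
  exists g : boolfun n, maiorana_mcfarland g /\ EA_equivalent g f.

Definition concat4 n (f1 f2 f3 f4 : boolfun n) : boolfun (n + 2) :=
  fun z =>
    let x := lsubmx z in
    let s := rsubmx z 0 ord0 in
    let t := rsubmx z 0 ord_max in
    if s == 0 then (if t == 0 then f1 x else f2 x)
    else (if t == 0 then f3 x else f4 x).

(* Main.v *)
Require Import Defs.
From mathcomp Require Import all_boot all_order all_algebra all_fingroup.
From mathcomp Require Import zify ring.
Set Implicit Arguments.
Unset Strict Implicit.
Unset Printing Implicit Defensive.
Import GRing.Theory.
Local Open Scope ring_scope.

(** Two facts about M-subspaces carry the second half of the claim. A function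
    in the completed Maiorana-McFarland class in [n] variables has an
    M-subspace of dimension at least [n / 2], namely the pullback, by the linear
    part of the affine permutation, of the space [y = 0], along whose cosets
    [g (x, y) = x . pi y + h y] is affine ([completed_MM_Msubspace]). In the other direction, write

      f (x, s, t) = (1 + s) f1 x + s (f3 x + t)

    for the concatenation of [f1], [f1], [f3], [f3 + 1], and let [W] be an
    M-subspace of [f]. Restricting second derivatives of [f] along directions
    with [s = 0] to the slices [s = 0] and [s = 1] shows that the projection to
    the variables [x] of the vectors of [W] with [s = 0] is an M-subspace of
    both [f1] and [f3]. This projection loses at most one dimension: imposing
    [s = 0] costs at most one, projecting costs one only if the vector
    [(0, 0, 1)] lies in [W], and both cannot happen, since the second
    derivative of [f] along [(0, 0, 1)] and a direction with [s = 1] is the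
    constant [1] ([common_Msubspace]).

    Were [f] in the completed class, [f1] and [f3] would thus share an
    M-subspace of dimension at least [m], hence one of dimension exactly [m];
    by uniqueness it would be both the canonical subspace and [U'].

    Bentness is a computation of Walsh coefficients: those of the concatenation
    at [(v, a, b)] are [2 W1(v)] if [b = 0] and [2 (-1)^a W3(v)] if [b = 1]
    ([bent_concat4]), and the Walsh coefficients of [f3] are, up to reindexing,
    those of [f1] ([walsh_comp_linear]). *)

(** * Arithmetic in the two-element field *)

Lemma F2_cases (a : 'F_2) : a = 0 \/ a = 1.
Proof. by case: a => [[|[|k]] // i]; [left | right]; apply/val_inj. Qed.

Lemma F2_nat2 : 2%:R = 0 :> 'F_2.
Proof. exact/val_inj. Qed.

(** Follows from [2 = 0], but [ring] has to be given it separately to cancel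
    a term that occurs four times. *)
Lemma F2_nat4 : 4%:R = 0 :> 'F_2.
Proof. exact/val_inj. Qed.

Definition sgn2 (a : 'F_2) : int := (-1) ^+ nat_of_ord a.
Arguments sgn2 : simpl never.

Lemma sgn2D (a b : 'F_2) : sgn2 (a + b) = sgn2 a * sgn2 b.
Proof. by case: (F2_cases a) => ->; case: (F2_cases b) => ->. Qed.

Lemma sum_F2 (F : 'F_2 -> int) : \sum_(a : 'F_2) F a = F 0 + F 1.
Proof.
rewrite (bigD1 0) //= (bigD1 1) //= big1 ?addr0 // => a.
by case: (F2_cases a) => ->.
Qed.

(** * Walsh transforms *)

Lemma dotDr n (u x y : 'rV['F_2]_n) : dot u (x + y) = dot u x + dot u y.
Proof.
by rewrite /dot -big_split; apply: eq_bigr => i _; rewrite mxE mulrDr.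
Qed.

Lemma dotDl n (u v x : 'rV['F_2]_n) : dot (u + v) x = dot u x + dot v x.
Proof.
by rewrite /dot -big_split; apply: eq_bigr => i _; rewrite mxE mulrDl.
Qed.

Lemma dot_mulmx n (u x : 'rV['F_2]_n) (N : 'M['F_2]_n) :
  dot u (x *m N) = dot (u *m N^T) x.
Proof.
have dotE (v y : 'rV['F_2]_n) : dot v y = (v *m y^T) 0 0.
  by rewrite mxE; apply: eq_bigr => i _; rewrite mxE.
by rewrite !dotE trmx_mul mulmxA.
Qed.

Lemma walshE n (f : boolfun n) u : walsh f u = \sum_x sgn2 (f x + dot u x).
Proof. by []. Qed.

Lemma eq_walsh n (f g : boolfun n) : f =1 g -> walsh f =1 walsh g.
Proof. by move=> fg u; apply: eq_bigr => x _; rewrite fg. Qed.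

Lemma walsh_add1 n (f : boolfun n) u : walsh (fun x => f x + 1) u = - walsh f u.
Proof.
rewrite /walsh -sumrN; apply: eq_bigr => x _.
by rewrite addrAC [LHS]sgn2D [sgn2 1]expr1 mulrN1.
Qed.

(** With [N] the matrix of the inverse of [L], the substitution of [L x] for the
    summation variable turns the character of [u] into that of [u *m N^T]. *)
Lemma walsh_comp_linear n (f : boolfun n)
    (L : {linear 'rV['F_2]_n -> 'rV['F_2]_n}) :
  bijective L -> forall u, exists v, walsh (fun x => f (L x)) u = walsh f v.
Proof.
move=> bL u.
have inj0 : lker (linfun L) == 0%VS.
  by apply/lker0P => x y; rewrite !lfunE; apply: (bij_inj bL).
have [N LN] : exists N : 'M['F_2]_n, forall x, L x *m N = x.
  exists (lin1_mx (linfun L)^-1%VF) => x; rewrite mul_rV_lin1 /=.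
  by have := lker0_lfunK inj0 x; rewrite lfunE.
exists (u *m N^T); rewrite /walsh [RHS](reindex L); last exact: onW_bij.
by apply: eq_bigr => x _; rewrite -dot_mulmx LN.
Qed.

(** * Bentness of the concatenation *)

Definition ext2 {n} (x : 'rV['F_2]_n) (s t : 'F_2) : 'rV['F_2]_(n + 2) :=
  row_mx x (\row_(j < 2) if j == ord0 then s else t).

Lemma ext2_l n (x : 'rV['F_2]_n) s t : lsubmx (ext2 x s t) = x.
Proof. exact: row_mxKl. Qed.

Lemma ext2_s n (x : 'rV['F_2]_n) s t : ext2 x s t 0 (rshift n ord0) = s.
Proof. by rewrite row_mxEr mxE. Qed.

Lemma ext2_t n (x : 'rV['F_2]_n) s t : ext2 x s t 0 (rshift n ord_max) = t.
Proof. by rewrite row_mxEr mxE. Qed.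

Lemma ext2K n (z : 'rV['F_2]_(n + 2)) :
  ext2 (lsubmx z) (z 0 (rshift n ord0)) (z 0 (rshift n ord_max)) = z.
Proof.
rewrite -[RHS]hsubmxK; congr row_mx; apply/rowP => j; rewrite !mxE.
case: j => [[|[|k]] // i]; rewrite /=; congr (z _ _); exact/val_inj.
Qed.

Lemma ext2D n (x y : 'rV['F_2]_n) s t s' t' :
  ext2 x s t + ext2 y s' t' = ext2 (x + y) (s + s') (t + t').
Proof.
rewrite /ext2 add_row_mx; congr row_mx; apply/rowP => j; rewrite !mxE.
by case: (j == ord0).
Qed.

Lemma dot_ext2 n (u : 'rV['F_2]_(n + 2)) (x : 'rV['F_2]_n) s t :
  dot u (ext2 x s t) = dot (lsubmx u) x
    + u 0 (rshift n ord0) * s + u 0 (rshift n ord_max) * t.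
Proof.
rewrite /dot big_split_ord /= 2!big_ord_recl big_ord0 addr0 addrA.
congr (_ + _ + _).
- by apply: eq_bigr => i _; rewrite row_mxEl mxE.
- by rewrite row_mxEr mxE.
- by rewrite row_mxEr mxE; congr (u _ _ * _); apply/val_inj.
Qed.

Lemma concat4_ext2 n (f1 f2 f3 f4 : boolfun n) x s t :
  concat4 f1 f2 f3 f4 (ext2 x s t) =
  if s == 0 then (if t == 0 then f1 x else f2 x)
  else (if t == 0 then f3 x else f4 x).
Proof. by rewrite /concat4 ext2_l /ext2 row_mxKr !mxE. Qed.

Lemma walsh_concat4 n (f1 f2 f3 f4 : boolfun n) (u : 'rV['F_2]_(n + 2)) :
  let v := lsubmx u in
  let a := u 0 (rshift n ord0) in let b := u 0 (rshift n ord_max) in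
  walsh (concat4 f1 f2 f3 f4) u =
    walsh f1 v + sgn2 b * walsh f2 v
    + sgn2 a * walsh f3 v + sgn2 (a + b) * walsh f4 v.
Proof.
move=> v a b.
pose h (p : 'rV['F_2]_n * ('F_2 * 'F_2)) := ext2 p.1 p.2.1 p.2.2.
have bh : bijective h.
  exists (fun z => (lsubmx z, (z 0 (rshift n ord0), z 0 (rshift n ord_max)))).
    by case=> x [s t]; rewrite /h ext2_l ext2_s ext2_t.
  by move=> z; rewrite /h ext2K.
rewrite !walshE (reindex h); last exact: onW_bij.
pose F x s t : int := sgn2 (concat4 f1 f2 f3 f4 (ext2 x s t) + dot u (ext2 x s t)).
transitivity (\sum_x \sum_s \sum_t F x s t).
  rewrite (eq_bigr (fun x => \sum_p F x p.1 p.2)) => [|x _]; last exact: pair_bigA.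
  by rewrite pair_bigA; apply: eq_bigr => -[].
rewrite !mulr_sumr -!big_split; apply: eq_bigr => x _ /=.
rewrite !sum_F2 /F !concat4_ext2 !dot_ext2 /= -/a -/b -/v !(mulr0, mulr1, addr0).
rewrite !sgn2D; ring.
Qed.

Lemma bent_concat4 n (f1 f3 : boolfun n) :
  bent f1 -> bent f3 -> bent (concat4 f1 f1 f3 (fun x => f3 x + 1)).
Proof.
move=> [ev b1] [_ b3]; split; first by rewrite oddD addbF.
move=> u; rewrite walsh_concat4 walsh_add1 sgn2D.
have -> : (n + 2)./2 = n./2.+1 by rewrite addn2.
rewrite exprSr; set v := lsubmx u.
have sg a : sgn2 a = 1 \/ sgn2 a = -1 by case: (F2_cases a) => ->; [left|right].
case: (sg (u 0 (rshift n ord0))) => ->; case: (sg (u 0 (rshift n ord_max))) => ->;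
case: (b1 v) => ->; case: (b3 v) => ->; by [left; ring | right; ring].
Qed.

(** * M-subspaces *)

Lemma Msubspace_sub {n} {f : boolfun n} {V W : {vspace 'rV['F_2]_n}} :
  (V <= W)%VS -> Msubspace f W -> Msubspace f V.
Proof. by move=> /subvP VW fW a b aV bV; apply: fW; apply: VW. Qed.

Lemma eq_Msubspace n (f g : boolfun n) V : f =1 g -> Msubspace f V -> Msubspace g V.
Proof. by move=> fg fV a b aV bV x; rewrite /deriv2 -!fg; apply: fV. Qed.

Lemma subspace_dim (F : fieldType) (vT : vectType F) (V : {vspace vT}) k :
  (k <= \dim V)%N -> exists2 W : {vspace vT}, (W <= V)%VS & \dim W = k.
Proof.
move=> kV; exists <<take k (vbasis V)>>%VS.
  rewrite -[X in (_ <= X)%VS](span_basis (vbasisP V)).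
  by apply: sub_span => x; apply: mem_take.
have /eqP -> : free (take k (vbasis V)).
  by apply: (@catl_free _ _ (drop k (vbasis V))); rewrite cat_take_drop (basis_free (vbasisP V)).
by rewrite size_takel // size_tuple.
Qed.

(** The witness is the space of the vectors whose image under the linear part
    [M] of the affine permutation has zero [y]-component. It is the kernel of a
    map to a space of half the dimension, so rank-nullity bounds its dimension
    from below. Along its directions [y] is constant, and [f] is affine. *)
Lemma completed_MM_Msubspace n (f : boolfun n) :
  completed_MM f ->
  exists W : {vspace 'rV['F_2]_n}, Msubspace f W /\ (n./2 <= \dim W)%N.
Proof.
case=> g [[m [e [pi [h gE]]]] EA]; case: _ / e f g gE EA => f g gE.
case=> A [l [[_ [M [c AE]]] [u [d lE]] fE]].
pose phi := linfun (@rsubmx 'F_2 1 m m \o mulmxr M).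
exists (lker phi); split; last first.
  have := limg_ker_dim phi fullv; rewrite capfv dimvf /dim /= mul1n => dimE.
  have := dimvS (subvf (limg phi)); rewrite [X in (_ <= X)%N -> _]dimvf /dim /= mul1n => leI.
  have -> : (m + m)./2 = m by lia.
  by rewrite -(leq_add2r m) -[X in (X <= _)%N]dimE leq_add2l.
move=> a b; rewrite !memv_ker !lfunE /= => /eqP a0 /eqP b0 x.
have gE' z : g z = dot (lsubmx z) (pi (rsubmx z)) + h (rsubmx z).
  by rewrite -gE castmx_id hsubmxK.
rewrite /deriv2 !fE !AE !mulmxDl !gE' !linearD /= a0 b0 !(addr0, add0r) !lE.
rewrite !dotDr !dotDl.
ring: F2_nat4 F2_nat2.
Qed.

(** The common M-subspace is the projection [p] to the first [n] coordinates of
    the part [W0] of [W] where the coordinate [s] vanishes. *)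
Lemma common_Msubspace n (f1 f3 : boolfun n) (W : {vspace 'rV['F_2]_(n + 2)}) :
  Msubspace (concat4 f1 f1 f3 (fun x => f3 x + 1)) W ->
  exists X : {vspace 'rV['F_2]_n},
    [/\ Msubspace f1 X, Msubspace f3 X & (\dim W <= (\dim X).+1)%N].
Proof.
set f := concat4 _ _ _ _ => fW.
have f0E x t : f (ext2 x 0 t) = f1 x by rewrite /f concat4_ext2 /=; case: ifP.
have f1E x t : f (ext2 x 1 t) = f3 x + t.
  by rewrite /f concat4_ext2 /=; case: (F2_cases t) => -> /=; rewrite ?addr0.
pose S := linfun (@col 'F_2 1 (n + 2) (rshift n ord0)).
pose p := linfun (@lsubmx 'F_2 1 n 2).
have SP z : (z \in lker S) = (z 0 (rshift n ord0) == 0).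
  rewrite memv_ker lfunE /=; apply/eqP/eqP => [/colP/(_ 0)|z0].
    by rewrite !mxE.
  by apply/colP => i; rewrite !mxE ord1.
pose W0 := (W :&: lker S)%VS.
have W0P z : z \in W0 -> exists x t, z = ext2 x 0 t /\ z \in W.
  rewrite memv_cap SP => /andP[zW /eqP z0].
  by exists (lsubmx z), (z 0 (rshift n ord_max)); split; rewrite // -z0 ext2K.
have W0deriv a b : a \in (p @: W0)%VS -> b \in (p @: W0)%VS ->
    forall x, deriv2 a b f1 x = 0 /\ deriv2 a b f3 x = 0.
  move=> /memv_imgP[_ /W0P[a' [s [-> aW]]] ->] /memv_imgP[_ /W0P[b' [t [-> bW]]] ->] x.
  rewrite !lfunE /= !ext2_l; split.
    by have := fW _ _ aW bW (ext2 x 0 0); rewrite /deriv2 !ext2D !addr0 !f0E.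
  (* On the slice [s = 1] the summand [t] is affine, so it does not contribute. *)
  have := fW _ _ aW bW (ext2 x 1 0); rewrite /deriv2 !ext2D !addr0 !f1E => <-.
  rewrite !add0r; ring: F2_nat4 F2_nat2.
exists (p @: W0)%VS; split; try by move=> a b aX bX x; case: (W0deriv a b aX bX x).
have dim0 := limg_ker_dim p W0; have dimW := limg_ker_dim S W; rewrite -/W0 in dimW.
have kerP z : z \in (W0 :&: lker p)%VS -> exists2 t, z = ext2 0 0 t & z \in W.
  rewrite memv_cap => /andP[/W0P[x [t [-> zW]]]].
  by rewrite memv_ker lfunE /= ext2_l => /eqP x0; exists t; rewrite ?x0 // -x0.
have ext0 : ext2 (0 : 'rV['F_2]_n) 0 0 = 0.
  by rewrite -[RHS]ext2K linear0 !mxE.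
pose e := ext2 (0 : 'rV['F_2]_n) 0 1.
case: (boolP (e \in W)) => eW.
  (* A vector of [W] with [s = 1] would make the second derivative along it and
     [e] equal to 1; so [W0 = W], and only the kernel of [p] costs a dimension. *)
  have WS : (W <= lker S)%VS.
    apply/subvP => z; rewrite SP -{1}(ext2K z).
    case: (F2_cases (z 0 (rshift n ord0))) => -> // /fW/(_ eW (ext2 0 0 0)).
    rewrite /deriv2 !ext2D !(addr0, add0r) !f0E !f1E.
    by rewrite [X in X = _ -> _](_ : _ = 1) //; ring: F2_nat4 F2_nat2.
  have : (W0 :&: lker p <= <[e]>)%VS.
    apply/subvP => z /kerP[t -> _].
    by case: (F2_cases t) => ->; rewrite ?ext0 ?mem0v ?memv_line.
  move/dimvS; rewrite dim_vline.
  have W0E : W0 = W by apply/capv_idPl.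
  move=> le1; rewrite -W0E -dim0 addnC -[X in (_ <= X)%N]addn1 leq_add2l.
  exact: leq_trans le1 (leq_b1 _).
(* Otherwise [p] is injective on [W0], and only the passage to [W0] costs a
   dimension. *)
have ker0 : (W0 :&: lker p = 0)%VS.
  apply/eqP; rewrite -subv0; apply/subvP => z /kerP[t ->].
  by case: (F2_cases t) => ->; rewrite ?ext0 ?mem0v ?(negPf eW) ?mem0v.
rewrite -dimW -dim0 ker0 dimv0 add0n -[X in (_ <= X)%N]addn1 leq_add2l.
by apply: leq_trans (dimvS (subvf _)) _; rewrite dimvf.
Qed.

Theorem corollary5p2 (m : nat) (hm : (3 <= m)%N)
    (pi : {perm 'rV['F_2]_m}) (h1 : boolfun m)
    (f1 f2 f3 f4 : boolfun (m + m))
    (hf1 : forall x y : 'rV['F_2]_m, f1 (row_mx x y) = dot x (pi y) + h1 y)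
    (hbent1 : bent f1)
    (hU : unique_Msubspace f1 m (canonical_subspace m))
    (L : {linear 'rV['F_2]_(m + m) -> 'rV['F_2]_(m + m)})
    (hL : bijective L)
    (U' : {vspace 'rV['F_2]_(m + m)})
    (hU' : unique_Msubspace (fun z => f1 (L z)) m U')
    (hUU' : U' <> canonical_subspace m)
    (hf2 : forall z, f2 z = f1 z)
    (hf3 : forall z, f3 z = f1 (L z))
    (hf4 : forall z, f4 z = f3 z + 1) :
  bent (concat4 f1 f2 f3 f4) /\ ~ completed_MM (concat4 f1 f2 f3 f4).
Proof.
have fE : concat4 f1 f2 f3 f4 =1 concat4 f1 f1 f3 (fun x => f3 x + 1).
  by move=> z; rewrite /concat4 hf2 hf4.
split.
  have bent3 : bent f3.
    case: hbent1 => ev b1; split=> // u; rewrite (eq_walsh hf3).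
    by have [v ->] := walsh_comp_linear f1 hL u; apply: b1.
  have [ev b] := bent_concat4 hbent1 bent3.
  by split=> // u; rewrite (eq_walsh fE); apply: b.
move=> /completed_MM_Msubspace[W [/(eq_Msubspace fE)/common_Msubspace]].
have -> : (m + m + 2)./2 = m.+1 by lia.
case=> X [X1 X3 dX] dW.
have [Y YX dY] := subspace_dim (leq_trans dW dX : (m <= \dim X)%N).
apply: hUU'; rewrite (hU.2 Y); last by split; last exact: Msubspace_sub YX X1.
apply: hU'.2; split=> //; apply: (eq_Msubspace hf3).
exact: Msubspace_sub YX X3.
Qed.
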